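(* For every $\delta>0$ there exists $n_0$ such that every triangle-free graph $G$ on $n\ge n_0$ vertices satisfies $$\chi_f(G)\le (\sqrt{2}+\delta)\sqrt{\frac{n}{\ln n}}.$$
   Context: The fractional chromatic number $\chi_f(G)$ of a finite graph $G$ is the minimum real number $r\ge 1$ such that there exists a probability distribution on the independent sets of $G$ under which a random independent set contains every vertex $v\in V(G)$ with probability at least $1/r$. A graph is triangle-free if it contains no three pairwise adjacent vertices. *)

(* Defs.v *)
From HB Require Import structures.
From mathcomp Require Import all_boot all_order all_algebra.
From mathcomp Require Import all_classical all_reals all_analysis.

Set Implicit Arguments.
Unset Strict Implicit.
Unset Printing Implicit Defensive.

Import Order.TTheory GRing.Theory Num.Theory.
Import numFieldNormedType.Exports.

Local Open Scope classical_set_scope.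
Local Open Scope ring_scope.

(* A finite simple graph is a symmetric irreflexive relation on a finType. *)

(* For irreflexive e, the three vertices are automatically distinct. *)
Definition triangle_free (T : finType) (e : rel T) : Prop :=
  forall x y z : T, ~ [/\ e x y, e y z & e x z].

Definition independent (T : finType) (e : rel T) (A : {set T}) : Prop :=
  forall x y : T, x \in A -> y \in A -> ~~ e x y.

Definition independent_dist (R : realType) (T : finType) (e : rel T)
    (P : {set T} -> R) : Prop :=
  [/\ forall A, 0 <= P A,
      \sum_(A : {set T}) P A = 1
    & forall A, ~ independent e A -> P A = 0].

Definition fractionally_colorable (R : realType) (T : finType) (e : rel T)
    (r : R) : Prop :=
  1 <= r /\
  exists2 P : {set T} -> R, independent_dist e P
    & forall v : T, r^-1 <= \sum_(A : {set T} | v \in A) P A.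

(* The infimum is a minimum: see fractional_chromatic_number_min below. *)
Definition fractional_chromatic_number (R : realType) (T : finType)
    (e : rel T) : R :=
  inf [set r : R | fractionally_colorable e r].

Lemma fractionally_colorable_has_inf (R : realType) (T : finType)
    (e : rel T) (e_irr : irreflexive e) :
  has_inf [set r : R | fractionally_colorable e r].
Proof.
split; last by exists 1 => r [].
have [T0|T0] := posnP #|T|.
  exists 1; split=> //; exists (fun A => (A == finset.set0)%:R); last first.
    by move=> v; move: (fintype0 v T0).
  split=> [A||A nA]; first exact: ler0n.
  - rewrite (bigD1 finset.set0) //= eqxx big1 ?addr0 // => A /negbTE ->.
    by [].
  - by case: eqP => // A0; case: nA => x; move: (fintype0 x T0).
have n0 : #|T|%:R != 0 :> R by rewrite pnatr_eq0 -lt0n.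
exists #|T|%:R; split; first by rewrite ler1n.
exists (fun A => \sum_(v : T) (A == finset.set1 v)%:R / #|T|%:R).
  split=> [A||A nA].
  - by apply: sumr_ge0 => v _; rewrite divr_ge0.
  - rewrite exchange_big /= (eq_bigr (fun=> #|T|%:R^-1)).
      by rewrite sumr_const -[LHS]mulr_natl mulfV.
    move=> v _; rewrite (bigD1 (finset.set1 v)) //= eqxx mul1r big1 ?addr0 //.
    by move=> A /negbTE ->; rewrite mul0r.
  - apply: big1 => v _; case: eqP => [Av|]; last by rewrite mul0r.
    by case: nA => x y; rewrite Av !inE => /eqP -> /eqP ->; rewrite e_irr.
move=> v; rewrite (bigD1 (finset.set1 v)) ?inE //= -[leLHS]addr0 lerD //.
  rewrite (bigD1 v) //= eqxx mul1r -[leLHS]addr0 lerD //.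
  by apply: sumr_ge0 => w _; rewrite divr_ge0.
by apply: sumr_ge0 => A _; apply: sumr_ge0 => w _; rewrite divr_ge0.
Qed.

Lemma sum_coord_continuous (R : realType) (T : finType) (p : pred {set T}) :
  continuous (fun P : prod_topology (fun _ : {set T} => R : topologicalType) =>
    \sum_(A : {set T} | p A) P A : R).
Proof.
apply: (@continuous_big R {set T} +%R 0 p (@add_continuous R)
  (prod_topology (fun _ : {set T} => R : topologicalType)) _
  (fun A P => P A)).
by move=> A _; exact: (@proj_continuous {set T} (fun=> R : topologicalType) A).
Qed.

Lemma fractional_chromatic_number_min (R : realType) (T : finType)
    (e : rel T) (e_irr : irreflexive e) :
  fractionally_colorable e (fractional_chromatic_number R e) /\
  (forall r : R, fractionally_colorable e r ->
    fractional_chromatic_number R e <= r).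
Proof.
have S_inf := fractionally_colorable_has_inf R e_irr.
rewrite /fractional_chromatic_number; set S := [set _ | _] in S_inf *.
set r0 := inf S.
split; last by move=> r Sr; apply: ge_inf => //; case: S_inf.
have r0_ge1 : 1 <= r0 by apply: lb_le_inf; [case: S_inf | move=> r []].
have r0_gt0 : 0 < r0 by exact: lt_le_trans r0_ge1.
split=> //.
have /choice[P PP] (n : nat) : exists P : {set T} -> R,
    independent_dist e P /\
    forall v, (r0 + n.+1%:R^-1)^-1 <= \sum_(A : {set T} | v \in A) P A.
  have n_gt0 : 0 < n.+1%:R^-1 :> R by rewrite invr_gt0.
  have [r [r_ge1 [P Pd Pv]] rlt] := inf_adherent n_gt0 S_inf.
  exists P; split=> // v; apply: le_trans (Pv v).
  rewrite lef_pV2 ?posrE ?(ltW rlt) ?addr_gt0 //.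
  exact: lt_le_trans r_ge1.
pose X := prod_topology (fun _ : {set T} => R : topologicalType).
have cubeP : compact [set f : X | forall A, `[0 : R, 1]%classic (f A)].
  exact: (@tychonoff _ (fun=> R : topologicalType) (fun=> `[0, 1]%classic)
    (fun=> @segment_compact R 0 1)).
have Fcube : ((P : nat -> X) @ \oo)
    [set f : X | forall A, `[0 : R, 1]%classic (f A)].
  exists 0%N => // n _ A; have [[P0 P1 _] _] := PP n.
  rewrite /= in_itv /= P0 /= -P1 (bigD1 A) //= lerDl.
  by apply: sumr_ge0 => B _; exact: P0.
have [Q [_ clQ]] := cubeP _ _ Fcube.
have lim_closed (p : pred {set T}) (D : set R) : closed D ->
    (\forall n \near \oo, D (\sum_(A | p A) P n A)) -> D (\sum_(A | p A) Q A).
  move=> Dcl PD.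
  have Ccl := preimage_closed (fun x _ => @sum_coord_continuous R T p x) Dcl.
  by apply: Ccl => B nB; apply: clQ.
have lim1 (A : {set T}) (D : set R) : closed D ->
    (forall n, D (P n A)) -> D (Q A).
  move=> Dcl PD; have := lim_closed (pred1 A) D Dcl.
  rewrite big_pred1_eq; apply; near=> n; rewrite big_pred1_eq; exact: PD.
exists Q.
  split=> [A||A nA].
  - have := lim1 A _ (@closed_ge R 0); apply=> n.
    by have [[+ _ _] _] := PP n; apply.
  - have := lim_closed xpredT _ (@closed_eq R 1); apply.
    by exists 0%N => // n _; have [[]] := PP n.
  - have := lim1 A _ (@closed_eq R 0); apply=> n.
    by have [[_ _ +] _] := PP n; apply.
move=> v; have cvgr : (r0 + n.+1%:R^-1)^-1 @[n --> \oo] --> r0^-1.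
  apply: cvgV; first by rewrite gt_eqF.
  rewrite -[X in _ --> X]addr0; apply: cvgD; first exact: cvg_cst.
  exact: cvg_harmonic.
rewrite leNgt; apply/negP => lt.
pose c := (\sum_(A : {set T} | v \in A) Q A + r0^-1) / 2.
have [c1 c2] := midf_lt lt.
have := lim_closed (fun A => v \in A) _ (@closed_ge R c).
have /[swap] /[apply] : \forall n \near \oo,
    c <= \sum_(A : {set T} | v \in A) P n A.
  near=> n; have [_ /(_ v)] := PP n; apply: le_trans; apply: ltW.
  by near: n; exact: (cvgr_gt _ cvgr).
by rewrite /= leNgt c1.
Unshelve. all: by end_near. Qed.

(* Main.v *)
(** By linear programming duality it suffices to find, for every weighting [c]
    of the vertices, an independent set of weight at least [c(V) / r], where
    [r] is the claimed bound.

    The heart is a weighted form of Shearer's theorem.  Give vertex [v] a rate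
    [x_v = exp (- z_v)] with [0 <= z_v <= Z], let [d_v] be the sum of the rates
    of its neighbours, and put [Phi z = sum_v c_v x_v z_v / (d_v + s)].  Choose
    [z] maximising [Phi] on the box.  A vertex with [z_v = 0] contributes
    nothing and can be deleted.  Otherwise no increase of a single rate
    increases [Phi]; this first-order condition, the convexity of [1 / (d + s)]
    and triangle-freeness show that if [u] is drawn with probability
    proportional to [x_u], the expected drop of [Phi] on deleting the closed
    neighbourhood of [u] is at most [1 + 2 Z / s] times the expectation of
    [c_u].  So some [u] can be put in the independent set, and one inducts.

    At the constant [z = Z] with [s = 2 Z / eps] this gives an independent set
    of weight at least [Z sum_v c_v / (deg v + s exp Z)], up to a factor
    [1 + eps].  Neighbourhoods are independent; if none of them is heavy enough,
    the [c]-average degree is at most [n / r], and Jensen's inequality bounds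
    the sum below by [c(V) / (n / r + s exp Z)].  Taking [Z] slightly below
    [ln n / 2] makes [s exp Z] negligible against [n / r], so that [r ^ 2] slightly
    above [2 n / ln n] is enough. *)

Require Import Defs.
From mathcomp Require Import all_boot all_order all_algebra.
From mathcomp Require Import all_classical all_reals all_analysis.
From mathcomp Require Import ring lra.

Set Implicit Arguments.
Unset Strict Implicit.
Unset Printing Implicit Defensive.

Import Order.TTheory GRing.Theory Num.Theory.
Import numFieldNormedType.Exports.

Local Open Scope ring_scope.

Lemma le0_of_le_smallM (R : realFieldType) (a b t0 : R) : 0 < t0 ->
  (forall t, 0 < t -> t <= t0 -> a <= t * b) -> a <= 0.
Proof.
move=> t0_gt0 le_a; apply/ler_addgt0Pr => eps eps_gt0; rewrite add0r.
have b1_gt0 : 0 < `|b| + 1 by rewrite ltr_wpDl.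
pose t := Num.min t0 (eps / (`|b| + 1)).
have t_gt0 : 0 < t by rewrite lt_min t0_gt0 divr_gt0.
apply: le_trans (le_a t t_gt0 _) _; first by rewrite ge_min lexx.
apply: (@le_trans _ _ (t * (`|b| + 1))).
  by rewrite ler_pM2l // (le_trans (ler_norm b)) // lerDl.
by rewrite -ler_pdivlMr // ge_min lexx orbT.
Qed.

Lemma sqr_max0B_le (R : realFieldType) (a h : R) :
  Num.max 0 (a - h) ^+ 2 <= Num.max 0 a ^+ 2 - 2 * h * Num.max 0 a + h ^+ 2.
Proof. by case: (leP 0 a) => a0; case: (leP 0 (a - h)) => ah0; nra. Qed.

Lemma continuous_sqr_max0B (R : realType) (b : R) :
  continuous (fun x : R => Num.max 0 (b - x) ^+ 2).
Proof.
move=> x; apply: (@continuous_comp R R R (fun y => Num.max 0 (b - y))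
  (fun y => y ^+ 2)); last exact: exprn_continuous.
apply: (@continuous_max R R (fun=> 0) (fun y => b - y)).
  exact: cst_continuous.
by apply: continuousB; [exact: cst_continuous | exact: cvg_id].
Qed.

Lemma divD_ge_tangent (R : realFieldType) (a D h : R) :
  0 <= a -> 0 < D -> 0 < D + h -> a / D - h * (a / D ^+ 2) <= a / (D + h).
Proof.
move=> a_ge0 D_gt0 Dh_gt0; rewrite -subr_ge0.
have -> : a / (D + h) - (a / D - h * (a / D ^+ 2)) =
    a * h ^+ 2 / (D ^+ 2 * (D + h)) by field; rewrite !gt_eqF.
by rewrite divr_ge0 // mulr_ge0 ?sqr_ge0 // ltW.
Qed.

Lemma sum_div_ge_of_mean_le (R : realFieldType) (I : finType) (c D : I -> R)
    (m : R) : (forall i, 0 <= c i) -> (forall i, 0 < D i) -> 0 < m ->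
  \sum_i c i * D i <= m * \sum_i c i -> (\sum_i c i) / m <= \sum_i c i / D i.
Proof.
move=> c_ge0 D_gt0 m_gt0 mean_le.
apply: (@le_trans _ _ (\sum_i (c i / m - (D i - m) * (c i / m ^+ 2)))).
  have -> : \sum_i (c i / m - (D i - m) * (c i / m ^+ 2)) =
      (\sum_i c i) / m + (m * \sum_i c i - \sum_i c i * D i) / m ^+ 2.
    rewrite [in RHS]mulr_sumr -sumrB !mulr_suml -big_split /=.
    by apply: eq_bigr => i _; ring.
  by rewrite lerDl divr_ge0 ?subr_ge0 ?sqr_ge0.
apply: ler_sum => i _.
by have := @divD_ge_tangent _ (c i) m (D i - m); rewrite addrCA subrr addr0; apply.
Qed.

Lemma expRN_affine_argmax_le (R : realType) (k B w : R) : 0 <= k -> 0 < w ->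
  (forall y, 0 <= y <= w -> expR (- y) * (k * y - B) <= expR (- w) * (k * w - B)) ->
  k * (w - 1) <= B.
Proof.
move=> k_ge0 w_gt0 w_max; rewrite -subr_le0.
apply: (@le0_of_le_smallM _ _ k w) => // t t_gt0 t_le.
have /w_max : 0 <= w - t <= w by lra.
rewrite opprB -[t - w]addrC expRD -mulrA ler_pM2l ?expR_gt0 // => max_t.
have [|A_gt0] := leP (k * (w - t) - B) 0; first by lra.
have : (1 + t) * (k * (w - t) - B) <= k * w - B.
  by apply: le_trans max_t; rewrite ler_pM2r ?expR_ge1Dx.
have -> : (1 + t) * (k * (w - t) - B) =
  k * w - B + t * (k * (w - 1) - B - t * k) by ring.
by rewrite gerDl pmulr_rle0 // subr_le0.
Qed.

Lemma mul_expRN_le (R : realType) (a b x : R) : 0 < a -> 0 < b ->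
  2 / (a ^+ 2 * b) <= x -> x * expR (- (a * x)) <= b.
Proof.
move=> a_gt0 b_gt0 le_x.
have ab_gt0 : 0 < a ^+ 2 * b by rewrite mulr_gt0 ?exprn_gt0.
have x_gt0 : 0 < x by apply: lt_le_trans le_x; rewrite divr_gt0.
rewrite expRN ler_pdivrMr ?expR_gt0 //.
have ax_ge0 : 0 <= a * x by rewrite mulr_ge0 ?ltW.
apply: le_trans (ler_wpM2l (ltW b_gt0) (expR_ge1Dxn 1 ax_ge0)).
rewrite [2`!]/= -[leLHS]mul1r; move: le_x; rewrite ler_pdivrMr // => le2.
have : 2 * x <= x * (a ^+ 2 * b) * x by rewrite ler_pM2r.
have -> : b * (1 + (a * x) ^+ 2 / 2) = b + x * (a ^+ 2 * b) * x / 2 by field.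
lra.
Qed.

Lemma exists_le_of_wsum_le (R : realDomainType) (I : finType) (P : pred I)
    (w f g : I -> R) (i0 : I) : P i0 -> (forall i, P i -> 0 < w i) ->
  \sum_(i | P i) w i * f i <= \sum_(i | P i) w i * g i ->
  exists2 i, P i & f i <= g i.
Proof.
move=> Pi0 w_gt0 le_sum; apply: contrapT => nex.
move: le_sum; apply/negP; rewrite -ltNge; apply: ltr_sum.
  by apply/hasP; exists i0 => //; exact: mem_index_enum.
move=> i Pi; rewrite ltr_pM2l ?w_gt0 // ltNge.
by apply/negP => fg; apply: nex; exists i.
Qed.

Section ProductTopology.
Local Open Scope classical_set_scope.

Lemma ptws_continuous (S T : topologicalType) (I : Type) (F : S -> {ptws I -> T}) :
  (forall i, continuous (fun x => F x i)) -> continuous F.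
Proof.
move=> cF x; apply/cvg_sup => i.
by move: x; apply: continuous_comp_initial; exact: cF.
Qed.

Lemma box_compact (R : realType) (I : eqType) (a b : I -> R) :
  compact [set f : {ptws I -> R} | forall i, a i <= f i <= b i].
Proof.
have := @tychonoff I (fun=> R : topologicalType) (fun i => `[a i, b i]%classic)
  (fun i => @segment_compact R (a i) (b i)).
congr compact; apply/seteqP; split=> f /= fab i; have := fab i;
  by rewrite /= in_itv.
Qed.

End ProductTopology.

Section Domination.
Local Open Scope classical_set_scope.
Context {R : realType} {I : finType}.
Variables (b : I -> R) (K : set {ptws I -> R}).
Implicit Types x y z : {ptws I -> R}.

Definition shortfall x i : R := Num.max 0 (b i - x i).

Lemma shortfall_ge0 x i : 0 <= shortfall x i.
Proof. by rewrite le_max lexx. Qed.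

Lemma shortfall_mulE x i : shortfall x i * (b i - x i) = shortfall x i ^+ 2.
Proof. by rewrite /shortfall; case: leP => // _; rewrite mul0r expr0n. Qed.

Lemma sqr_shortfall_continuous :
  continuous (fun x => \sum_i shortfall x i ^+ 2).
Proof.
apply: (continuous_big (@add_continuous R)) => i _ x.
apply: (@continuous_comp _ R R (fun x => x i) (fun r => Num.max 0 (b i - r) ^+ 2)).
  exact: proj_continuous.
exact: continuous_sqr_max0B.
Qed.

Lemma sum_sqr_shortfall_le x y (t : R) :
  \sum_i shortfall (fun i => x i + t * (y i - x i)) i ^+ 2 <=
  \sum_i shortfall x i ^+ 2 - 2 * t * \sum_i shortfall x i * (y i - x i)
    + t ^+ 2 * \sum_i (y i - x i) ^+ 2.
Proof.
rewrite !mulr_sumr -sumrB -big_split /=; apply: ler_sum => i _.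
rewrite {1}/shortfall opprD addrA.
have := @sqr_max0B_le R (b i - x i) (t * (y i - x i)).
by rewrite -/(shortfall x i) exprMn; lra.
Qed.

Hypothesis K_convex : convex_set K.

Lemma convex_set_segment x y (t : R) : K x -> K y -> 0 <= t <= 1 ->
  K (fun i => x i + t * (y i - x i)).
Proof.
move=> Kx Ky /andP[t_ge0 t_le1].
have /set_mem := K_convex (Itv01 t_ge0 t_le1) (mem_set Ky) (mem_set Kx).
congr K; apply/funext => i.
by rewrite -[LHS]/(t * y i + (1 - t) * x i); ring.
Qed.

Lemma shortfall_argmin_variational x y : K x -> K y ->
  (forall z, K z -> \sum_i shortfall x i ^+ 2 <= \sum_i shortfall z i ^+ 2) ->
  \sum_i shortfall x i * (y i - x i) <= 0.
Proof.
move=> Kx Ky x_min; set slope := \sum_i _; set dist2 := \sum_i (y i - x i) ^+ 2.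
apply: (@le0_of_le_smallM _ _ (dist2 / 2) 1) => // t t_gt0 t_le1.
have /x_min : K (fun i => x i + t * (y i - x i)).
  by apply: convex_set_segment; rewrite // ltW.
move=> /le_trans /(_ (sum_sqr_shortfall_le x y t)).
rewrite -/slope -/dist2 -addrA lerDl => le_t.
have : 0 <= t * (t * (dist2 / 2) - slope) by lra.
by rewrite pmulr_rge0 // subr_ge0.
Qed.

(* A point of [K] with least total squared shortfall has none: otherwise its
   shortfalls would be weights contradicting the hypothesis. *)
Lemma compact_convex_exists_ge : compact K ->
  (forall c : I -> R, (forall i, 0 <= c i) ->
    exists2 x, K x & \sum_i c i * b i <= \sum_i c i * x i) ->
  exists2 x, K x & forall i, b i <= x i.
Proof.
move=> K_compact wsum_ge.
have K_nonempty : K !=set0.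
  by have [x Kx _] := wsum_ge (fun=> 0) (fun=> lexx _); exists x.
have [x /set_mem Kx x_min] := compact_EVT_min K_nonempty K_compact
  (continuous_subspaceT sqr_shortfall_continuous).
exists x => // i.
have [y Ky wsum_y] := wsum_ge _ (shortfall_ge0 x).
have slope_le0 := shortfall_argmin_variational Kx Ky
  (fun z Kz => x_min z (mem_set Kz)).
have sum_eq0 : \sum_j shortfall x j ^+ 2 = 0.
  apply/le_anti/andP; split; last by apply: sumr_ge0 => j _; exact: sqr_ge0.
  apply: le_trans slope_le0; under eq_bigr do rewrite -shortfall_mulE mulrBr.
  by under [leRHS]eq_bigr do rewrite mulrBr; rewrite !sumrB lerD2r.
have /eqP := psumr_eq0P (fun j _ => sqr_ge0 (shortfall x j)) sum_eq0 (erefl : xpredT i).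
rewrite sqrf_eq0 => /eqP shortfall0.
by rewrite -subr_le0 -shortfall0 le_max lexx orbT.
Qed.

End Domination.

Section FractionalColoring.
Local Open Scope classical_set_scope.
Context {R : realType} {T : finType}.
Variable e : rel T.
Implicit Types P : {ptws {set T} -> R}.

Definition marginal P : {ptws T -> R} := fun v => \sum_(A : {set T} | v \in A) P A.

Lemma marginal_continuous : continuous marginal.
Proof. by apply: ptws_continuous => v; exact: sum_coord_continuous. Qed.

Lemma independent_dist_compact :
  compact [set P : {ptws {set T} -> R} | independent_dist e P].
Proof.
apply: (@subclosed_compact _ _ _ _ (@box_compact R {set T} (fun=> 0) (fun=> 1))).
  have -> : [set P : {ptws {set T} -> R} | independent_dist e P] =
      (\bigcap_(A in setT) [set P | 0 <= P A]) `&` [set P | \sum_A P A = 1] `&`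
      (\bigcap_(A in [set A | ~ independent e A]) [set P | P A = 0]).
    apply/seteqP; split=> P /=.
      move=> [P_ge0 P1 P_indep]; split=> [|A]; last exact: P_indep.
      by split=> // A _; exact: P_ge0.
    by move=> [[P_ge0 P1] P_indep]; split=> // A; exact: P_ge0.
  apply: closedI; first apply: closedI.
  - apply: closed_bigI => A _; apply: (preimage_closed _ (@closed_ge R 0)).
    by move=> P _; exact: proj_continuous.
  - apply: (preimage_closed _ (@closed_eq R 1)).
    by move=> P _; exact: (@sum_coord_continuous R T xpredT).
  - apply: closed_bigI => A _; apply: (preimage_closed _ (@closed_eq R 0)).
    by move=> P _; exact: proj_continuous.
move=> P [P_ge0 P1 _] A; rewrite P_ge0 /= -P1 (bigD1 A) //= lerDl.
by apply: sumr_ge0 => B _; exact: P_ge0.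
Qed.

Lemma marginal_image_convex : convex_set (marginal @` [set P | independent_dist e P]).
Proof.
move=> _ _ t /set_mem[P [P_ge0 P1 P_indep] <-] /set_mem[Q [Q_ge0 Q1 Q_indep] <-].
apply/mem_set; exists (fun A => t%:num * P A + (1 - t%:num) * Q A).
  have t_le1 : 0 <= 1 - t%:num by rewrite subr_ge0.
  split=> [A||A nA].
  - by rewrite addr_ge0 ?mulr_ge0.
  - by rewrite big_split -!mulr_sumr /= P1 Q1 !mulr1 addrC subrK.
  - by rewrite P_indep ?Q_indep // !mulr0 addr0.
by apply/funext => v; rewrite /marginal big_split /= -!mulr_sumr.
Qed.

Lemma independent_dist_dirac (A : {set T}) : independent e A ->
  independent_dist e (fun B => (B == A)%:R : R).
Proof.
move=> A_indep; split=> [B||B nB]; first exact: ler0n.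
  by rewrite (bigD1 A) //= eqxx big1 ?addr0 // => B /negbTE ->.
by case: eqP nB => // -> /(_ A_indep).
Qed.

Lemma marginal_dirac (A : {set T}) v :
  marginal (fun B => (B == A)%:R) v = (v \in A)%:R.
Proof.
rewrite /marginal big_mkcond (bigD1 A) //= eqxx big1 ?addr0.
  by case: (v \in A).
by move=> B /negbTE ->; case: ifP.
Qed.

Lemma fractionally_colorable_of_weights (r : R) : 1 <= r ->
  (forall c : T -> R, (forall v, 0 <= c v) ->
    exists2 A : {set T}, independent e A & \sum_v c v <= r * \sum_(v in A) c v) ->
  fractionally_colorable e r.
Proof.
move=> r_ge1 heavy; split=> //.
have r_gt0 : 0 < r by exact: lt_le_trans r_ge1.
have [||_ [P P_dist <-] P_ge] :=
    @compact_convex_exists_ge R T (fun=> r^-1) _ marginal_image_convex.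
- apply: continuous_compact independent_dist_compact.
  exact: continuous_subspaceT marginal_continuous.
- move=> c c_ge0; have [A A_indep le_c] := heavy c c_ge0.
  exists (marginal (fun B => (B == A)%:R)).
    by exists (fun B => (B == A)%:R) => //; exact: independent_dist_dirac.
  rewrite -mulr_suml ler_pdivrMr // mulrC; move: le_c; congr (_ <= _ * _).
  rewrite big_mkcond; apply: eq_bigr => v _; rewrite marginal_dirac.
  by case: (v \in A); rewrite ?mulr1 ?mulr0.
by exists P.
Qed.

End FractionalColoring.

Section Graph.
Context {T : finType}.
Variable e : rel T.
Hypotheses (e_sym : symmetric e) (e_irr : irreflexive e).
Implicit Types (S A : {set T}) (u v : T).

Lemma nbhd_independent v : triangle_free e -> independent e [set u | e v u]%SET.
Proof.
move=> e_tri x y; rewrite !inE => evx evy; apply/negP => exy.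
by case: (e_tri v x y).
Qed.

Lemma independentU1 u A : independent e A -> (forall v, v \in A -> ~~ e u v) ->
  independent e (u |: A).
Proof.
move=> A_indep uA x y; rewrite !inE => /orP[/eqP->|xA] /orP[/eqP->|yA].
- by rewrite e_irr.
- exact: uA.
- by rewrite e_sym uA.
- exact: A_indep.
Qed.

Definition nonnbrs S u : {set T} := [set v in S | (v != u) && ~~ e u v].

Lemma nonnbrs_proper S u : u \in S -> nonnbrs S u \proper S.
Proof.
move=> uS; apply/fintype.properP; split; last first.
  by exists u => //; rewrite inE eqxx andbF.
by apply/fintype.subsetP => v; rewrite inE => /andP[].
Qed.

Lemma sum_closed_nbhd (V : nmodType) S u (F : T -> V) : u \in S ->
  \sum_(v in S) F v =
  F u + \sum_(v in S | e u v) F v + \sum_(v in nonnbrs S u) F v.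
Proof.
move=> uS; rewrite (bigD1 u) //= (bigID (e u)) /= addrA; congr (_ + _ + _).
  by apply: eq_bigl => v; case: eqVneq => [->|_]; rewrite ?e_irr ?andbF ?andbT.
by apply: eq_bigl => v; rewrite inE -andbA.
Qed.

Lemma sum_nbrs_exchange (R : comPzRingType) S (f g : T -> R) :
  \sum_(u in S) f u * \sum_(v in S | e u v) g v =
  \sum_(v in S) g v * \sum_(u in S | e v u) f u.
Proof.
under eq_bigr do rewrite big_mkcondr mulr_sumr.
rewrite exchange_big /=; apply: eq_bigr => v _.
rewrite big_mkcondr mulr_sumr; apply: eq_bigr => u _.
by rewrite e_sym; case: ifP => _; rewrite ?mulr0 // mulrC.
Qed.

Lemma sum_mul_degree (R : comPzRingType) (c : T -> R) :
  \sum_v c v * #|e v|%:R = \sum_v \sum_(u in [set u | e v u]%SET) c u.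
Proof.
transitivity (\sum_v \sum_(u | e v u) c v).
  by apply: eq_bigr => v _; rewrite sumr_const mulr_natr.
under eq_bigr do rewrite big_mkcond; rewrite exchange_big /=.
apply: eq_bigr => v _; rewrite [RHS]big_mkcond /=; apply: eq_bigr => u _.
by rewrite inE e_sym.
Qed.

End Graph.

Section Potential.
Context {R : realType} {T : finType}.
Variables (e : rel T) (c : T -> R) (s : R).
Hypotheses (e_sym : symmetric e) (e_irr : irreflexive e).
Hypotheses (c_ge0 : forall v, 0 <= c v) (s_gt0 : 0 < s).
Implicit Types (S : {set T}) (z : {ptws T -> R}) (u v y : T).

Definition rate z v : R := expR (- z v).

Definition wdeg S z v : R := \sum_(u in S | e v u) rate z u.

Definition codeg S z u v : R := \sum_(y in S | e u y && e v y) rate z y.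

Definition mass z v : R := c v * (rate z v * z v).

Definition contribution S z v : R := mass z v / (wdeg S z v + s).

Definition potential S z : R := \sum_(v in S) contribution S z v.

(* Minus the derivative of [contribution S z v] with respect to [wdeg S z v]. *)
Definition sensitivity S z v : R := mass z v / (wdeg S z v + s) ^+ 2.

(* No increase of a single rate increases the potential, to first order. *)
Definition stationary S z : Prop := forall y, y \in S ->
  c y * (z y - 1) / (wdeg S z y + s) <= \sum_(v in S | e y v) sensitivity S z v.

Lemma rate_gt0 z v : 0 < rate z v.
Proof. exact: expR_gt0. Qed.

Lemma rate_le1 z v : 0 <= z v -> rate z v <= 1.
Proof. by move=> zv_ge0; rewrite /rate -[leRHS]expR0 ler_expR oppr_le0. Qed.

Lemma wdeg_ge0 S z v : 0 <= wdeg S z v.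
Proof. by apply: sumr_ge0 => u _; exact/ltW/rate_gt0. Qed.

Lemma wdegD_gt0 S z v : 0 < wdeg S z v + s.
Proof. by rewrite ltr_wpDl // wdeg_ge0. Qed.

Lemma wdeg_subset S' S z v : S' \subset S -> wdeg S' z v <= wdeg S z v.
Proof.
move=> /fintype.subsetP sub; rewrite /wdeg big_mkcond [leRHS]big_mkcond.
apply: ler_sum => u _; case: ifPn => [/andP[/sub -> ->] //|_].
by case: ifP => // _; exact/ltW/rate_gt0.
Qed.

Lemma mass_ge0 z v : 0 <= z v -> 0 <= mass z v.
Proof. by move=> zv_ge0; rewrite !mulr_ge0 // ltW // rate_gt0. Qed.

Lemma potential_continuous S : continuous (potential S).
Proof.
have cz v : continuous (fun z => z v) by exact: proj_continuous.
have cr v : continuous (fun z => rate z v).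
  move=> z; apply: (@continuous_comp _ R R (fun z => z v) (fun r => expR (- r))).
    exact: cz.
  apply: (@continuous_comp R R R -%R expR); first exact: opp_continuous.
  exact: continuous_expR.
have cd v : continuous (fun z => wdeg S z v).
  by apply: (continuous_big (@add_continuous R)) => u _; exact: cr.
apply: (continuous_big (@add_continuous R)) => v _ z.
apply: (@continuousM R _ (mass^~ v) (fun z => (wdeg S z v + s)^-1)).
  apply: (@continuousM R _ (fun=> c v) (fun z => rate z v * z v)).
    exact: cst_continuous.
  by apply: (@continuousM R _ (rate^~ v) (fun z => z v)); [exact: cr | exact: cz].
apply: continuousV; first by rewrite gt_eqF ?wdegD_gt0.
apply: (@continuousD R R _ (fun z => wdeg S z v) (fun=> s)); first exact: cd.
exact: cst_continuous.
Qed.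

Lemma potential_argmax S (Z : R) : 0 <= Z ->
  exists2 z, forall v, 0 <= z v <= Z &
    forall z', (forall v, 0 <= z' v <= Z) -> potential S z' <= potential S z.
Proof.
move=> Z_ge0; pose box : set {ptws T -> R} := [set z | forall v, 0 <= z v <= Z]%classic.
have box_nonempty : (box !=set0)%classic by exists (fun=> 0) => v; rewrite lexx.
have [z /set_mem zZ z_max] := compact_EVT_max box_nonempty
  (@box_compact R T (fun=> 0) (fun=> Z)) (continuous_subspaceT (@potential_continuous S)).
by exists z => // z' z'Z; apply: z_max; exact: mem_set.
Qed.

Lemma potential_le_setD1 S z v : v \in S -> (forall u, 0 <= z u) -> z v = 0 ->
  potential S z <= potential (S :\ v) z.
Proof.
move=> vS z_ge0 zv0; rewrite /potential (big_setD1 v) //= /contribution {1}/mass.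
rewrite zv0 !mulr0 mul0r add0r; apply: ler_sum => u _.
rewrite ler_wpM2l ?mass_ge0 // lef_pV2 ?posrE ?wdegD_gt0 // lerD2r.
exact/wdeg_subset/finset.subD1set.
Qed.

Lemma wdeg_dfwith_nbr S z y (t : R) v : y \in S -> e v y ->
  wdeg S (dfwith z y t) v = wdeg S z v + (expR (- t) - rate z y).
Proof.
move=> yS evy; rewrite /wdeg (bigD1 y) ?yS //= [in RHS](bigD1 y) ?yS //=.
rewrite {1}/rate dfwithin; under eq_bigr => u /andP[_ uy].
  rewrite {1}/rate dfwithout 1?eq_sym // -/(rate z u).
  over.
ring.
Qed.

Lemma wdeg_dfwith_nonnbr S z y (t : R) v : ~~ e v y ->
  wdeg S (dfwith z y t) v = wdeg S z v.
Proof.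
move=> evy; apply: eq_bigr => u /andP[_ evu]; rewrite /rate dfwithout //.
by apply: contraNneq evy => ->.
Qed.

Lemma contribution_tangent S S' z z' v : 0 <= z v -> z' v = z v ->
  contribution S z v - (wdeg S' z' v - wdeg S z v) * sensitivity S z v <=
  contribution S' z' v.
Proof.
move=> zv_ge0 z'v; have mass_z' : mass z' v = mass z v by rewrite /mass /rate z'v.
have DE : wdeg S' z' v + s = wdeg S z v + s + (wdeg S' z' v - wdeg S z v) by ring.
rewrite /contribution mass_z' DE.
by apply: divD_ge_tangent; rewrite -?DE ?mass_ge0 ?wdegD_gt0.
Qed.

Lemma potential_dfwith_ge S z y (t : R) : y \in S -> (forall v, 0 <= z v) ->
  potential S z
    + c y / (wdeg S z y + s) * (expR (- t) * t - rate z y * z y)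
    - (expR (- t) - rate z y) * \sum_(v in S | e y v) sensitivity S z v
  <= potential S (dfwith z y t).
Proof.
move=> yS z_ge0; set z' := dfwith z y t; set h := expR (- t) - rate z y.
have at_y : contribution S z' y = contribution S z y
    + c y / (wdeg S z y + s) * (expR (- t) * t - rate z y * z y).
  rewrite /contribution /mass wdeg_dfwith_nonnbr ?e_irr // /rate /z' dfwithin.
  by ring.
have off_y v : v \in S -> v != y ->
    contribution S z v - (if e y v then h * sensitivity S z v else 0)
    <= contribution S z' v.
  move=> vS vy; have z'v : z' v = z v by rewrite /z' dfwithout 1?eq_sym.
  apply: le_trans (contribution_tangent S S (z_ge0 v) z'v); rewrite lerB //.
  case: ifPn => [eyv|eyv]; last by rewrite wdeg_dfwith_nonnbr 1?e_sym // subrr mul0r.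
  by rewrite wdeg_dfwith_nbr 1?e_sym // addrC addKr.
rewrite [X in _ - _ * X]big_mkcondr [X in _ - _ * X](bigD1 y) //= e_irr add0r.
rewrite mulr_sumr /potential [X in X + _ - _](bigD1 y) //= [leRHS](bigD1 y) //= at_y.
rewrite -!addrA lerD2l addrCA lerD2l -sumrB; apply: ler_sum => v /andP[vS vy].
by have := off_y v vS vy; case: ifP; rewrite ?mulr0.
Qed.

Lemma potential_coord_argmax_le S z y : y \in S -> (forall v, 0 <= z v) -> 0 < z y ->
  (forall t, 0 <= t <= z y -> potential S (dfwith z y t) <= potential S z) ->
  c y * (z y - 1) / (wdeg S z y + s) <= \sum_(v in S | e y v) sensitivity S z v.
Proof.
move=> yS z_ge0 zy_gt0 z_max; rewrite mulrAC.
apply: expRN_affine_argmax_le => // [|t t_le].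
  by rewrite divr_ge0 // ltW // wdegD_gt0.
have := le_trans (potential_dfwith_ge t yS z_ge0) (z_max t t_le).
by rewrite /rate; lra.
Qed.

Lemma potential_argmax_stationary S z (Z : R) :
  (forall v, 0 <= z v <= Z) -> (forall v, v \in S -> 0 < z v) ->
  (forall z', (forall v, 0 <= z' v <= Z) -> potential S z' <= potential S z) ->
  stationary S z.
Proof.
move=> zZ z_gt0 z_max y yS; have z_ge0 v : 0 <= z v by case/andP: (zZ v).
apply: potential_coord_argmax_le => // [|t /andP[t_ge0 t_le]]; first exact: z_gt0.
apply: z_max => v; have [<-|yv] := eqVneq y v; last by rewrite dfwithout.
by rewrite dfwithin t_ge0 (le_trans t_le) //; case/andP: (zZ y).
Qed.

Lemma codegxx S z u : codeg S z u u = wdeg S z u.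
Proof. by apply: eq_bigl => y; rewrite andbb. Qed.

Lemma wdeg_nonnbrs S z u v : ~~ e u v ->
  wdeg S z v = wdeg (nonnbrs e S u) z v + codeg S z u v.
Proof.
move=> euv; rewrite /wdeg (bigID (e u)) /= addrC; congr (_ + _); apply: eq_bigl => y.
  rewrite !inE; case: (eqVneq y u) => [->|_]; last by rewrite andbAC.
  by rewrite e_sym (negbTE euv) !andbF.
by rewrite -andbA; congr (_ && _); rewrite andbC.
Qed.

(* Both sides sum over the walks u - y - v of length two. *)
Lemma sum_codeg S z (b : T -> R) :
  \sum_(u in S) rate z u * \sum_(v in S) b v * codeg S z u v =
  \sum_(y in S) rate z y * wdeg S z y * \sum_(v in S | e y v) b v.
Proof.
have through_midpoint u : \sum_(v in S) b v * codeg S z u v =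
    \sum_(y in S | e u y) rate z y * \sum_(v in S | e y v) b v.
  transitivity (\sum_(v in S) b v * \sum_(y in S | e v y)
      (if e u y then rate z y else 0)).
    apply: eq_bigr => v _; congr (_ * _); rewrite -big_mkcondr.
    by apply: eq_bigl => y; rewrite -andbA [e u y && _]andbC.
  rewrite sum_nbrs_exchange // [RHS]big_mkcondr; apply: eq_bigr => y _.
  by case: ifP; rewrite ?mul0r.
under eq_bigr do rewrite through_midpoint.
by rewrite sum_nbrs_exchange //; apply: eq_bigr => y _; rewrite mulrAC.
Qed.

Hypothesis e_tri : triangle_free e.

Lemma codeg_adj_eq0 S z u v : e u v -> codeg S z u v = 0.
Proof.
by move=> euv; apply: big1 => y /and3P[_ euy evy]; case: (e_tri (And3 euv evy euy)).
Qed.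

Lemma potential_nonnbrs_drop S z u : u \in S -> (forall v, 0 <= z v) ->
  potential S z - potential (nonnbrs e S u) z <=
  contribution S z u + \sum_(v in S | e u v) contribution S z v
  - \sum_(v in S) sensitivity S z v * codeg S z u v + sensitivity S z u * wdeg S z u.
Proof.
move=> uS z_ge0; rewrite /potential (sum_closed_nbhd e_irr _ uS).
rewrite [\sum_(v in S) _ * codeg _ _ _ _](sum_closed_nbhd e_irr _ uS) codegxx.
rewrite [\sum_(v in S | _) _ * codeg _ _ _ _]big1 ?addr0; last first.
  by move=> v /andP[_ euv]; rewrite codeg_adj_eq0 ?mulr0.
have : \sum_(v in nonnbrs e S u)
      (contribution S z v + sensitivity S z v * codeg S z u v) <=
    \sum_(v in nonnbrs e S u) contribution (nonnbrs e S u) z v.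
  apply: ler_sum => v; rewrite inE => /and3P[vS vu euv].
  apply: le_trans (contribution_tangent S (nonnbrs e S u) (z_ge0 v) (erefl (z v))).
  by rewrite (wdeg_nonnbrs S z euv) opprD addNKr mulNr opprK mulrC.
by rewrite big_split /=; lra.
Qed.

Lemma vertex_expected_drop_le S z v (Z : R) : 0 <= z v <= Z ->
  rate z v * contribution S z v + contribution S z v * wdeg S z v
    - rate z v * wdeg S z v * (c v * (z v - 1) / (wdeg S z v + s))
    + rate z v * (sensitivity S z v * wdeg S z v)
  <= (1 + 2 * Z / s) * (rate z v * c v).
Proof.
move=> /andP[zv_ge0 zv_le]; rewrite /contribution /sensitivity /mass.
have D_gt0 := wdegD_gt0 S z v; have d_ge0 := wdeg_ge0 S z v.
have x_gt0 := rate_gt0 z v; have x_le1 := rate_le1 zv_ge0.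
set x := rate z v in x_gt0 x_le1 *; set d := wdeg S z v in D_gt0 d_ge0 *.
rewrite [leLHS](_ : _ = (d / (d + s) + x * z v / (d + s) * (1 + d / (d + s)))
    * (x * c v)); last by field; rewrite gt_eqF.
rewrite ler_wpM2r ?mulr_ge0 ?(ltW x_gt0) //.
have frac_ge0 : 0 <= d / (d + s) by rewrite divr_ge0 // ltW.
have frac_le1 : d / (d + s) <= 1 by rewrite ler_pdivrMr // mul1r lerDl ltW.
have xz_ge0 : 0 <= x * z v by rewrite mulr_ge0 // ltW.
have xz_le : x * z v / (d + s) <= Z / s.
  apply: ler_pM => //; first by rewrite invr_ge0 ltW.
    by rewrite -[leRHS]mul1r ler_pM // ltW.
  by rewrite lef_pV2 ?posrE // lerDr.
have -> : 2 * Z / s = Z / s * 2 by ring.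
by rewrite lerD // ler_pM ?divr_ge0 ?addr_ge0 ?(ltW D_gt0) ?(ltW s_gt0) //; lra.
Qed.

Lemma expected_drop_le S z (Z : R) : (forall v, 0 <= z v <= Z) -> stationary S z ->
  \sum_(u in S) rate z u * (potential S z - potential (nonnbrs e S u) z) <=
  \sum_(u in S) rate z u * ((1 + 2 * Z / s) * c u).
Proof.
move=> zZ z_stationary; have z_ge0 v : 0 <= z v by case/andP: (zZ v).
apply: (@le_trans _ _ (\sum_(u in S) rate z u * (contribution S z u +
    \sum_(v in S | e u v) contribution S z v -
    \sum_(v in S) sensitivity S z v * codeg S z u v +
    sensitivity S z u * wdeg S z u))).
  apply: ler_sum => u uS; rewrite ler_wpM2l ?potential_nonnbrs_drop //.
  exact/ltW/rate_gt0.
under eq_bigr do rewrite mulrDr mulrBr mulrDr.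
rewrite big_split /= sumrB big_split /= sum_nbrs_exchange // sum_codeg.
apply: (@le_trans _ _ (\sum_(v in S) (rate z v * contribution S z v +
    contribution S z v * wdeg S z v -
    rate z v * wdeg S z v * (c v * (z v - 1) / (wdeg S z v + s)) +
    rate z v * (sensitivity S z v * wdeg S z v)))).
  rewrite big_split /= sumrB big_split /= lerD2r lerB //.
  apply: ler_sum => y yS; rewrite ler_wpM2l ?z_stationary //.
  by rewrite mulr_ge0 ?wdeg_ge0 // ltW // rate_gt0.
by apply: ler_sum => v _; rewrite [leRHS]mulrCA; exact: vertex_expected_drop_le.
Qed.

Lemma exists_vertex_drop_le S z (Z : R) : S != finset.set0 ->
  (forall v, 0 <= z v <= Z) -> (forall v, v \in S -> 0 < z v) ->
  (forall z', (forall v, 0 <= z' v <= Z) -> potential S z' <= potential S z) ->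
  exists2 u, u \in S &
    potential S z <= (1 + 2 * Z / s) * c u + potential (nonnbrs e S u) z.
Proof.
move=> /finset.set0Pn[v0 v0S] zZ z_gt0 z_max.
have [u uS le_u] := exists_le_of_wsum_le v0S (fun u _ => rate_gt0 z u)
  (expected_drop_le zZ (potential_argmax_stationary zZ z_gt0 z_max)).
by exists u => //; rewrite -lerBlDr.
Qed.

Lemma potential_le_independent (Z : R) S z : 0 <= Z -> (forall v, 0 <= z v <= Z) ->
  exists A : {set T}, [/\ independent e A, A \subset S &
    potential S z <= (1 + 2 * Z / s) * \sum_(v in A) c v].
Proof.
move=> Z_ge0; have [n] := ubnP #|S|.
elim: n => // n IH in S z *; rewrite ltnS => S_le zZ.
have [->|S_nonempty] := eqVneq S finset.set0.
  exists finset.set0; split; [by move=> x y; rewrite inE | exact: finset.sub0set |].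
  by rewrite /potential !big_set0 mulr0.
have [w wZ w_max] := potential_argmax S Z_ge0.
suff [A [A_indep AS le_A]] : exists A : {set T}, [/\ independent e A, A \subset S &
    potential S w <= (1 + 2 * Z / s) * \sum_(v in A) c v].
  by exists A; split=> //; apply: le_trans le_A; exact: w_max.
have w_ge0 v : 0 <= w v by case/andP: (wZ v).
have [v /andP[vS /eqP wv0]|w_neq0] := pickP [pred v in S | w v == 0].
  have [|A [A_indep AS le_A]] := IH (S :\ v) w _ wZ.
    by apply: leq_trans S_le; apply: proper_card; exact: properD1.
  exists A; split=> //; first exact: fintype.subset_trans AS (finset.subD1set _ _).
  by apply: le_trans le_A; exact: potential_le_setD1.
have [|u uS le_u] := exists_vertex_drop_le S_nonempty wZ _ w_max.
  by move=> v vS; rewrite lt_def w_ge0 andbT; have := w_neq0 v; rewrite /= vS => /negbT.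
have /proper_card N_lt := nonnbrs_proper e uS.
have [|A [A_indep AN le_A]] := IH (nonnbrs e S u) w _ wZ; first exact: leq_trans S_le.
have A_nonnbr v : v \in A -> [/\ v \in S, v != u & ~~ e u v].
  by move=> /(fintype.subsetP AN); rewrite inE => /and3P.
exists (u |: A); split.
- by apply: independentU1 => // v /A_nonnbr[].
- by rewrite finset.subUset finset.sub1set uS; apply/fintype.subsetP => v /A_nonnbr[].
- rewrite big_setU1 /=; last by apply/negP => /A_nonnbr[_]; rewrite eqxx.
  by rewrite mulrDr; apply: le_trans le_u _; rewrite lerD2l.
Qed.

End Potential.

Section TriangleFree.
Context {R : realType} {T : finType}.
Variable e : rel T.
Hypotheses (e_sym : symmetric e) (e_irr : irreflexive e) (e_tri : triangle_free e).

Lemma weighted_shearer (c : T -> R) (Z eps : R) :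
  (forall v, 0 <= c v) -> 0 < Z -> 0 < eps ->
  exists2 A : {set T}, independent e A &
    Z * \sum_v c v / (#|e v|%:R + 2 * Z * expR Z / eps) <=
    (1 + eps) * \sum_(v in A) c v.
Proof.
move=> c_ge0 Z_gt0 eps_gt0; pose s := 2 * Z / eps.
have s_gt0 : 0 < s by rewrite !mulr_gt0 ?invr_gt0.
have [|A [A_indep _ le_A]] := potential_le_independent e_sym e_irr c_ge0 s_gt0 e_tri
  finset.setT (ltW Z_gt0) (z := fun=> Z).
  by move=> v; rewrite lexx ltW.
exists A => //; move: le_A.
have -> : 1 + 2 * Z / s = 1 + eps by rewrite /s; field; rewrite !gt_eqF.
apply: le_trans; rewrite [leLHS](_ : _ = potential e c s finset.setT (fun=> Z)) //.
rewrite mulr_sumr; apply: eq_big => [v|v _]; first by rewrite inE.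
have wdegE : wdeg e finset.setT (fun=> Z) v = expR (- Z) * #|e v|%:R.
  by rewrite mulr_natr -sumr_const; apply: eq_bigl => u; rewrite inE.
rewrite /contribution /mass wdegE /rate expRN /s; field; rewrite !gt_eqF ?expR_gt0 //.
by rewrite ltr_wpDl ?mulr_ge0 ?(ltW eps_gt0) // !mulr_gt0 ?expR_gt0.
Qed.

Lemma exists_heavy_independent (c : T -> R) (r Z eps : R) :
  (forall v, 0 <= c v) -> 0 < r -> 0 < Z -> 0 < eps ->
  (1 + eps) * (#|T|%:R / r + 2 * Z * expR Z / eps) <= Z * r ->
  exists2 A : {set T}, independent e A & \sum_v c v <= r * \sum_(v in A) c v.
Proof.
move=> c_ge0 r_gt0 Z_gt0 eps_gt0; set C := \sum_v c v.
set s := 2 * Z * expR Z / eps; set m := _ / r + s => le_m.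
have s_gt0 : 0 < s by rewrite !mulr_gt0 ?invr_gt0 ?expR_gt0.
have m_gt0 : 0 < m by rewrite ltr_wpDl // divr_ge0 // ltW.
have [[v heavy_nbhd]|light_nbhds] :=
    pselect (exists v, C <= r * \sum_(u in [set u | e v u]%SET) c u).
  by exists [set u | e v u]%SET => //; exact: nbhd_independent.
have mean_degree_le : \sum_v c v * (#|e v|%:R + s) <= m * C.
  under eq_bigr do rewrite mulrDr; rewrite big_split /= -mulr_suml mulrDl.
  rewrite -/C [C * s]mulrC lerD2r (sum_mul_degree e_sym) mulrAC -mulrA mulr_natl.
  rewrite -sumr_const; apply: ler_sum => v _; rewrite ler_pdivlMr // mulrC leNgt.
  by apply/negP => /ltW heavy; apply: light_nbhds; exists v.
have degreeD_gt0 v : 0 < #|e v|%:R + s by rewrite ltr_wpDl.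
have [A A_indep le_A] := weighted_shearer c_ge0 Z_gt0 eps_gt0.
exists A => //; have eps1_gt0 : 0 < 1 + eps by rewrite ltr_pwDl // ltW.
have ZCm_le : Z * (C / m) <= (1 + eps) * \sum_(v in A) c v.
  apply: le_trans le_A; rewrite ler_pM2l //.
  exact: sum_div_ge_of_mean_le.
rewrite -(ler_pM2l eps1_gt0) mulrCA; apply: le_trans (ler_wpM2l (ltW r_gt0) ZCm_le).
have -> : r * (Z * (C / m)) = Z * r * (C / m) by ring.
apply: le_trans (ler_wpM2r _ le_m); last by rewrite divr_ge0 ?sumr_ge0 // ltW.
by rewrite [leLHS](_ : _ = (1 + eps) * m * (C / m)) //; field; rewrite gt_eqF.
Qed.

Lemma triangle_free_fractionally_colorable (r Z eps : R) :
  1 <= r -> 0 < Z -> 0 < eps ->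
  (1 + eps) * (#|T|%:R / r + 2 * Z * expR Z / eps) <= Z * r ->
  fractionally_colorable e r.
Proof.
move=> r_ge1 Z_gt0 eps_gt0 le_r; apply: fractionally_colorable_of_weights => // c c_ge0.
by apply: exists_heavy_independent le_r; rewrite // (lt_le_trans ltr01).
Qed.

End TriangleFree.

Section HeightChoice.
Context {R : realType}.
(* [L] stands for the logarithm of the number of vertices, [r] for the number of
   colours. *)
Variables (eta L r : R).
Hypotheses (eta_gt0 : 0 < eta) (r_gt0 : 0 < r) (L_ge : 16 / eta ^+ 4 <= L).
Hypothesis r_ge : 2 * expR L <= (1 - 4 * eta) * L * r ^+ 2.

(* Slightly below [L / 2], so that [expR height] is negligible against
   [expR (L / 2)]. *)
Definition height : R := (1 - eta) * L / 2.

Let L_gt0 : 0 < L.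
Proof. by apply: lt_le_trans L_ge; rewrite divr_gt0 // exprn_gt0. Qed.

Let eta_lt : 4 * eta < 1.
Proof.
rewrite -subr_gt0; have : 0 < (1 - 4 * eta) * L * r ^+ 2.
  by apply: lt_le_trans r_ge; rewrite mulr_gt0 ?expR_gt0.
by rewrite -mulrA pmulr_lgt0 // mulr_gt0 ?exprn_gt0.
Qed.

Lemma height_gt0 : 0 < height.
Proof. by rewrite !mulr_gt0 ?invr_gt0 // subr_gt0; have := eta_lt; lra. Qed.

Lemma colors_ge1 : 1 <= r.
Proof.
rewrite -(@expr_ge1 _ 2) ?(ltW r_gt0) // -(ler_pM2l L_gt0) mulr1.
have : 0 <= eta * (L * r ^+ 2) by rewrite !mulr_ge0 ?exprn_ge0 // ltW.
by have := expR_ge1Dx L; have := r_ge; have := L_gt0; lra.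
Qed.

Lemma expR_half_le_colors : expR (L / 2) <= L * r.
Proof.
have L_ge1 : 1 <= L.
  apply: le_trans L_ge; rewrite ler_pdivlMr ?exprn_gt0 // mul1r.
  have : eta ^+ 4 <= 1 by rewrite exprn_ile1 ?ltW //; have := eta_lt; lra.
  lra.
rewrite -(@ler_pXn2r _ 2) ?nnegrE ?expR_ge0 ?mulr_ge0 ?(ltW L_gt0) ?(ltW r_gt0) //.
rewrite -expRM_natl mulrC divfK // exprMn.
have : 0 <= eta * (L * r ^+ 2) by rewrite !mulr_ge0 ?exprn_ge0 // ltW.
have : L * r ^+ 2 <= L ^+ 2 * r ^+ 2.
  by rewrite ler_wpM2r ?sqr_ge0 // expr2 ler_peMl // ltW.
by have := expR_gt0 L; have := r_ge; lra.
Qed.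

Lemma expR_height_le_colors : expR height <= eta ^+ 2 / 2 * r.
Proof.
have -> : height = L / 2 + - (eta / 2 * L) by rewrite /height; field.
rewrite expRD; apply: le_trans (ler_wpM2r (expR_ge0 _) expR_half_le_colors) _.
rewrite mulrAC ler_pM2r //; apply: mul_expRN_le; rewrite ?divr_gt0 ?exprn_gt0 //.
by rewrite [leLHS](_ : _ = 16 / eta ^+ 4) //; field; rewrite gt_eqF.
Qed.

Lemma height_shearer_condition :
  (1 + eta) * (expR L / r + 2 * height * expR height / eta) <= height * r.
Proof.
have degree_term : expR L / r <= (1 - 4 * eta) * L / 2 * r.
  by rewrite ler_pdivrMr //; have := r_ge; lra.
have offset_term : 2 * height * expR height / eta <= eta * height * r.
  have -> : eta * height * r = 2 * height / eta * (eta ^+ 2 / 2 * r).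
    by field; rewrite gt_eqF.
  rewrite mulrAC ler_wpM2l ?expR_height_le_colors // divr_ge0 ?(ltW eta_gt0) //.
  by rewrite mulr_ge0 // ltW // height_gt0.
apply: le_trans (ler_wpM2l _ (lerD degree_term offset_term)) _.
  by rewrite addr_ge0 // ltW.
rewrite -subr_ge0 [leRHS](_ : _ = L / 2 * (eta * (1 + 4 * eta + eta ^+ 2)) * r).
  by rewrite !mulr_ge0 ?addr_ge0 ?mulr_ge0 ?sqr_ge0 // ltW.
by rewrite /height; field.
Qed.

End HeightChoice.

Lemma sqr_sqrt2D_ge (R : realType) (delta : R) : 0 <= delta ->
  2 * (1 + delta) <= (Num.sqrt 2 + delta) ^+ 2.
Proof.
move=> delta_ge0; have sqrt2_ge1 : 1 <= Num.sqrt 2 :> R.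
  by rewrite -[leLHS]sqrtr1 ler_sqrt // ler1n.
have : Num.sqrt 2 ^+ 2 = 2 :> R by rewrite sqr_sqrtr.
nra.
Qed.

Lemma sqr_color_bound_ge (R : realType) (delta n L : R) :
  0 < delta -> 0 < n -> 0 < L ->
  2 * n <= (1 - 4 * (delta / (4 * (1 + delta)))) * L
             * ((Num.sqrt 2 + delta) * Num.sqrt (n / L)) ^+ 2.
Proof.
move=> delta_gt0 n_gt0 L_gt0; have delta1_gt0 : 0 < 1 + delta by rewrite addr_gt0.
rewrite exprMn sqr_sqrtr ?divr_ge0 ?(ltW n_gt0) ?(ltW L_gt0) //.
rewrite [leRHS](_ : _ = n * ((Num.sqrt 2 + delta) ^+ 2 / (1 + delta))).
  by rewrite mulrC ler_pM2l // ler_pdivlMr // sqr_sqrt2D_ge ?ltW.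
by field; rewrite !gt_eqF.
Qed.

Theorem theorem1p4 (R : realType) (delta : R) (delta_gt0 : 0 < delta) :
  exists n0 : nat, forall (T : finType) (e : rel T),
    symmetric e -> irreflexive e -> triangle_free e -> (n0 <= #|T|)%N ->
    fractional_chromatic_number R e
      <= (Num.sqrt 2 + delta) * Num.sqrt (#|T|%:R / ln #|T|%:R).
Proof.
pose eta := delta / (4 * (1 + delta)).
have eta_gt0 : 0 < eta by rewrite divr_gt0 // mulr_gt0 // addr_gt0.
exists (Num.bound (expR (16 / eta ^+ 4))) => T e e_sym e_irr e_tri n_ge.
set n : R := #|T|%:R; set L := ln n; set r := _ * Num.sqrt _.
have expR_le_n : expR (16 / eta ^+ 4) <= n.
  by apply: le_trans (ltW (archi_boundP (expR_ge0 _))) _; rewrite ler_nat.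
have n_gt0 : 0 < n by exact: lt_le_trans (expR_gt0 _) expR_le_n.
have expR_L : expR L = n by rewrite lnK.
have L_ge : 16 / eta ^+ 4 <= L by rewrite -ler_expR expR_L.
have L_gt0 : 0 < L by apply: lt_le_trans L_ge; rewrite divr_gt0 // exprn_gt0.
have r_gt0 : 0 < r.
  by rewrite mulr_gt0 ?sqrtr_gt0 ?divr_gt0 // addr_gt0 // sqrtr_gt0.
have r_ge : 2 * expR L <= (1 - 4 * eta) * L * r ^+ 2.
  by rewrite expR_L; exact: sqr_color_bound_ge.
have [_] := fractional_chromatic_number_min R e_irr; apply.
apply: (triangle_free_fractionally_colorable e_sym e_irr e_tri (colors_ge1 _ _ L_ge r_ge)
  (height_gt0 _ _ L_ge r_ge) eta_gt0) => //.
by rewrite -/n -expR_L; exact: height_shearer_condition.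
Qed.
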